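(* Let $S$ be a Polish space, $\nu\in\mathcal{P}(S)$, and let $\Gamma\subset C_b(S)$ be admissible. Then for every $g\in\Gamma$, $$\log\int_S e^g\,d\nu=\sup_{\mu\in\mathcal{P}(S)}\left\{\int_S g\,d\mu-G_\Gamma(\mu\Vert\nu)\right\}.$$
   Context: $\mathcal{P}(S)$ is the set of Borel probability measures on $S$, $\mathcal{M}(S)$ the finite signed Borel measures, $C_b(S)$ the bounded continuous functions $S\to\mathbb{R}$, endowed with the weak topology induced by $\mathcal{M}(S)$ (the coarsest topology making $g\mapsto\int_S g\,d\mu$ continuous for every $\mu\in\mathcal{M}(S)$). A set $\Gamma\subset C_b(S)$ is called admissible if: (1) $\Gamma$ is convex and closed (in this weak topology); (2) $g\in\Gamma$ implies $-g\in\Gamma$, and $\Gamma$ contains all constant functions; (3) for all $\mu,\nu\in\mathcal{P}(S)$ with $\mu\ne\nu$ there is $g\in\Gamma$ with $\int_S g\,d\mu\neq\int_S g\,d\nu$. The $\Gamma$-divergence is $G_\Gamma(\mu\Vert\nu)=\sup_{g\in\Gamma}\{\int_S g\,d\mu-\log\int_S e^g\,d\nu\}$, with values in $[0,\infty]$ for $\mu,\nu\in\mathcal{P}(S)$. *)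

(* Defs.v *)
From HB Require Import structures.
From mathcomp Require Import all_boot all_order all_algebra.
From mathcomp Require Import all_classical all_reals all_analysis.

Set Implicit Arguments.
Unset Strict Implicit.
Unset Printing Implicit Defensive.
Import Order.TTheory GRing.Theory Num.Theory.
Import numFieldNormedType.Exports.

Local Open Scope classical_set_scope.
Local Open Scope ring_scope.
Local Open Scope ereal_scope.

Definition separable (S : topologicalType) : Prop :=
  exists2 D : set S, countable D & dense D.

Definition completely_metrizable (R : realType) (S : topologicalType) : Prop :=
  exists m : Metric R S, let M : metricType R := Metric.Pack m in
    (forall A : set S, @open S A <-> @open M A) /\
    (forall F : set_system M, ProperFilter F -> cauchy F -> exists l : M, F --> l).

Definition polish (R : realType) (S : topologicalType) : Prop :=
  separable S /\ completely_metrizable R S.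

(* Measurable types are pointed in the library, hence [ptopologicalType]; a
   space carrying a probability measure is nonempty, so nothing is lost. *)
Notation borel S := (g_sigma_algebraType (@open S)).

Definition Cb (R : realType) (S : topologicalType) : set (S -> R) :=
  [set g | continuous g /\ bounded_fun g].

(* The integral against a signed measure is the difference of the integrals
   against its Jordan parts; these do not depend on the Hahn decomposition. *)
Definition charge_integral d (T : measurableType d) (R : realType)
    (mu : {charge set T -> \bar R}%R) (g : T -> R) : R :=
  let P := cid (Hahn_decomposition mu) in
  let N := cid (projT2 P) in
  let PN := projT2 N in
  (\int[jordan_pos PN]_x g x - \int[jordan_neg PN]_x g x)%R.

(* The coarsest topology on [Cb] making [g |-> \int g dmu] continuous for every
   finite signed measure [mu]. *)
Definition weakCb (R : realType) (S : ptopologicalType) : topologicalType :=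
  @sup_topology (@Cb R S) ({charge set (borel S) -> \bar R})%R
    (fun mu => Topological.class (initial_topology
      (fun g : @Cb R S => charge_integral mu (set_val g : borel S -> R)))).

(* Functions of type [set T -> \bar R] may take arbitrary values on
   nonmeasurable sets, so measures are compared on measurable sets only. *)
Definition same_measure d (T : measurableType d) (R : realType)
    (mu nu : set T -> \bar R) : Prop :=
  forall A, measurable A -> mu A = nu A.

Record admissible (R : realType) (S : ptopologicalType) (Gamma : set (S -> R))
    : Prop := Admissible {
  admissible_Cb : Gamma `<=` @Cb R S ;
  admissible_convex : @convex_set R (S -> R^o) Gamma ;
  admissible_closed : closed [set g : weakCb R S | Gamma (set_val g)] ;
  admissible_opp : forall g, Gamma g -> Gamma (fun x => - g x)%R ;
  admissible_cst : forall c : R, Gamma (fun=> c) ;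
  admissible_sep : forall mu nu : probability (borel S) R,
    ~ same_measure mu nu ->
    exists2 g, Gamma g & \int[mu]_x (g x)%:E != \int[nu]_x (g x)%:E }.

Definition Gdivergence (R : realType) (S : ptopologicalType)
    (Gamma : set (S -> R)) (mu nu : probability (borel S) R) : \bar R :=
  ereal_sup [set \int[mu]_x (g x)%:E - lne (\int[nu]_x (expR (g x))%:E)
            | g in Gamma].

(* Main.v *)
Require Import Defs.
From HB Require Import structures.
From mathcomp Require Import all_boot all_order all_algebra.
From mathcomp Require Import all_classical all_reals all_analysis.
From mathcomp Require Import measurable_realfun.
Import Order.TTheory GRing.Theory Num.Theory.
Import numFieldNormedType.Exports.
Local Open Scope classical_set_scope.
Local Open Scope ring_scope.

(** Write [L h] for the logarithm of the [nu]-integral of [exp h].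

    The inequality [>=] is the Fenchel-Young inequality built into the
    definition of the divergence: [g] itself competes in the supremum that
    defines it, so the divergence of [mu] from [nu] is at least the
    [mu]-integral of [g] minus [L g].

    For [<=] the supremum is attained, at the Gibbs measure [mu] whose density
    with respect to [nu] is [exp (g - L g)]. For any other bounded [h],
    Jensen's inequality for the exponential ([Rintegral_le_ln_expR]) applied to
    [h - g] under [mu] says that the [mu]-integral of [h - g] is at most the
    logarithm of the [mu]-integral of [exp (h - g)], and that logarithm is
    [L h - L g] because the density cancels [exp (- g)]. Rearranged, this says
    that [g] maximizes [h |-> \int h dmu - L h] over all bounded measurable
    functions ([gibbs_measure_maximizes]), in particular over [Gamma]. Hence
    the divergence of [mu] from [nu] equals [\int g dmu - L g], and [mu] gives
    the value [L g] in the supremum.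

    The remaining lemmas provide the measure with a prescribed density and its
    change-of-variables formula ([probability_of_density]), and the
    integrability that keeps every quantity except the divergence itself
    finite. *)

Lemma continuous_borel_measurable (R : realType) (S : ptopologicalType)
    (g : S -> R) :
  continuous g -> measurable_fun setT (g : borel S -> R).
Proof.
move=> cg mT; apply: (measurability _ (RGenOInfty.measurableE R)) => //.
move=> /= _ [_ [x ->] <-]; rewrite setTI; apply: sub_sigma_algebra.
by move/continuousP: cg; apply; exact: interval_open.
Qed.

Lemma finite_measure_bounded_integrable (d : measure_display)
    (T : measurableType d) (R : realType)
    (mu : {finite_measure set T -> \bar R}) (f : T -> R) :
  measurable_fun setT f -> bounded_fun f ->
  mu.-integrable setT (EFin \o f).
Proof.
move=> mf bf; apply: measurable_bounded_integrable => //.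
by rewrite ltey_eq fin_num_measure.
Qed.

Section bounded_functions.
Context {T : Type} {R : realType}.
Implicit Types f g : T -> R.

Lemma bounded_fun_leP f :
  bounded_fun f <-> exists M, forall x, `|f x| <= M.
Proof.
split=> [[M [_ Mf]]|[M Mf]].
  by exists (M + 1) => x; apply: Mf => //; rewrite ltrDl.
by exists M; split=> [|N /ltW MN x _]; [exact: num_real|exact: le_trans MN].
Qed.

Lemma bounded_fun_sub f g :
  bounded_fun f -> bounded_fun g -> bounded_fun (fun x => f x - g x).
Proof.
move=> /bounded_fun_leP[M fM] /bounded_fun_leP[N gN].
apply/bounded_fun_leP; exists (M + N) => x.
by rewrite (le_trans (ler_normB _ _))// lerD.
Qed.

Lemma bounded_fun_expR f : bounded_fun f -> bounded_fun (fun x => expR (f x)).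
Proof.
move=> /bounded_fun_leP[M fM]; apply/bounded_fun_leP; exists (expR M) => x.
by rewrite ger0_norm ?expR_ge0// ler_expR (le_trans (ler_norm _)).
Qed.

End bounded_functions.

Section exponential_moment.
Context {d} {T : measurableType d} {R : realType}.
Variables (P : probability T R) (f : T -> R).
Hypotheses (mf : measurable_fun setT f) (bf : bounded_fun f).

Lemma integrable_expR : P.-integrable setT (EFin \o (fun x => expR (f x))).
Proof.
apply: finite_measure_bounded_integrable; last exact: bounded_fun_expR.
exact: measurableT_comp.
Qed.

Lemma Rintegral_expR_gt0 : 0 < \int[P]_x expR (f x).
Proof.
have /bounded_fun_leP[M fM] := bf.
apply: (@lt_le_trans _ _ (\int[P]_x expR (- M))).
  by rewrite Rintegral_cst//= probability_setT mulr1 expR_gt0.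
apply: le_Rintegral => //.
- exact: finite_measure_integrable_cst.
- exact: integrable_expR.
- by move=> x _; rewrite ler_expR lerNl (le_trans _ (fM x))// -normrN ler_norm.
Qed.

Lemma EFin_Rintegral_expR :
  (\int[P]_x (expR (f x))%:E)%E = (\int[P]_x expR (f x))%:E.
Proof.
by rewrite /Rintegral fineK//; exact: integrable_fin_num integrable_expR.
Qed.

Lemma lne_integral_expR :
  lne (\int[P]_x (expR (f x))%:E)%E = (ln (\int[P]_x expR (f x)))%:E.
Proof. by rewrite EFin_Rintegral_expR lne_EFin// Rintegral_expR_gt0. Qed.

(** Jensen's inequality for the exponential. The tangent line
    [1 + y <= exp y], taken at [y = f x - ln Z] with [Z] the exponential
    moment, has right-hand side of integral 1. *)
Lemma Rintegral_le_ln_expR :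
  \int[P]_x f x <= ln (\int[P]_x expR (f x)).
Proof.
set Z := \int[P]_x expR (f x); have Z0 : 0 < Z := Rintegral_expR_gt0.
have if_ : P.-integrable setT (EFin \o f).
  exact: finite_measure_bounded_integrable.
have ic (c : R) : P.-integrable setT (EFin \o fun=> c).
  exact: finite_measure_integrable_cst.
have ieZ : P.-integrable setT (EFin \o fun x => Z^-1 * expR (f x)).
  rewrite (_ : _ \o _ = fun x => (Z^-1)%:E * (expR (f x))%:E)%E//.
  by apply: integrableZl => //; exact: integrable_expR.
have E1 : \int[P]_x (f x - ln Z + 1) = \int[P]_x f x - ln Z + 1.
  rewrite RintegralD ?RintegralB ?Rintegral_cst//=.
    by rewrite probability_setT/= !mulr1.
  by rewrite (_ : _ \o _ = (EFin \o f) \- (EFin \o fun=> ln Z))%E//;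
     exact: integrableB.
have E2 : \int[P]_x (Z^-1 * expR (f x)) = 1.
  by rewrite RintegralZl//; [rewrite mulVf// gt_eqF|exact: integrable_expR].
rewrite -subr_le0 -(lerD2r 1) add0r -E1 -[leRHS]E2; apply: le_Rintegral => //.
  rewrite (_ : _ \o _ = ((EFin \o f) \- (EFin \o fun=> ln Z)) \+
    (EFin \o fun=> 1%R))%E//.
  by apply: integrableD => //; exact: integrableB.
move=> x _; rewrite addrC (le_trans (expR_ge1Dx _))// expRD expRN lnK//.
by rewrite mulrC.
Qed.

End exponential_moment.

Section density.
Context {d} {T : measurableType d} {R : realType}.
Variables (mu : probability T R) (w : T -> R).
Hypotheses (mw : measurable_fun setT w) (w0 : forall x, 0 <= w x).
Hypothesis w1 : (\int[mu]_x (w x)%:E = 1)%E.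

(** The set function [A |-> \int[mu]_(x in A) w x] is a probability dominated
    by [mu], so its Radon-Nikodym derivative agrees with [w] almost everywhere
    and the change-of-variables formula for the derivative transfers to [w]. *)
Lemma probability_of_density : exists P : probability T R,
  forall f, P.-integrable setT (EFin \o f) ->
    (\int[P]_x (f x)%:E = \int[mu]_x (f x * w x)%:E)%E.
Proof.
have /measurable_EFinP mEw := mw.
pose m := fun A : set T => (\int[mu]_(x in A) (w x)%:E)%E.
have m0 : m set0 = 0%E by rewrite /m integral_set0.
have mge0 A : (0 <= m A)%E by apply: integral_ge0 => x _; rewrite lee_fin.
have madd : semi_sigma_additive m.
  by apply: semi_sigma_additive_nng_induced => // x; rewrite lee_fin.
pose M : {measure set T -> \bar R} :=
  HB.pack m (isMeasure.Build _ _ _ m m0 mge0 madd).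
pose P : probability T R :=
  HB.pack (Measure.sort M) (Measure_isProbability.Build _ _ _ M w1).
have PE A : P A = (\int[mu]_(x in A) (w x)%:E)%E by [].
have Pmu : P `<< mu.
  apply/null_content_dominatesP => A mA muA0; rewrite PE.
  by apply: null_set_integral => //; exact: measurable_funTS.
exists P => f Pf; have mf := measurable_int P Pf.
rewrite -(Radon_Nikodym_change_of_variables Pmu)//.
have mRN : measurable_fun setT (Radon_Nikodym (charge_of_finite_measure P) mu).
  by apply: measurable_int; exact: Radon_Nikodym_integrable.
apply: ae_eq_integral => //.
- exact: emeasurable_funM.
- by rewrite (_ : (fun x => _) = (EFin \o f) \* (EFin \o w))%E//;
     exact: emeasurable_funM.
- rewrite (_ : (fun x => (f x * w x)%:E) = (EFin \o f) \* (EFin \o w))%E//.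
  apply: ae_eqe_mul2l; apply: integral_ae_eq => //.
    exact: Radon_Nikodym_integrable.
  by move=> A _ mA; rewrite -Radon_Nikodym_integral.
Qed.

End density.

(** The witness is the exponential tilt of [nu] by [g]: under it [exp (h - g)]
    integrates to the quotient of the exponential moments of [h] and [g], which
    turns Jensen's inequality for [h - g] into the maximality of [g]. *)
Lemma gibbs_measure_maximizes (d : measure_display)
    (T : measurableType d) (R : realType) (nu : probability T R) (g : T -> R) :
  measurable_fun setT g -> bounded_fun g ->
  exists mu : probability T R, forall h : T -> R,
    measurable_fun setT h -> bounded_fun h ->
    \int[mu]_x h x - ln (\int[nu]_x expR (h x)) <=
    \int[mu]_x g x - ln (\int[nu]_x expR (g x)).
Proof.
move=> mg bg; set Z := \int[nu]_x expR (g x).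
have Z0 : 0 < Z by exact: Rintegral_expR_gt0.
have ZV0 : 0 <= Z^-1 by rewrite invr_ge0 ltW.
have [||| mu muE] := @probability_of_density _ _ _ nu
  (fun x => expR (g x) * Z^-1).
- by apply: measurable_funM => //; exact: measurableT_comp.
- by move=> x; rewrite mulr_ge0 ?expR_ge0.
- under eq_integral do rewrite EFinM.
  rewrite integralZr//; last exact: integrable_expR.
  by rewrite EFin_Rintegral_expR// -EFinM mulfV// gt_eqF.
exists mu => h mh bh.
have mhg : measurable_fun setT (fun x => h x - g x) by exact: measurable_funB.
have bhg := bounded_fun_sub _ _ bh bg.
have E : \int[mu]_x expR (h x - g x) = (\int[nu]_x expR (h x)) / Z.
  rewrite [LHS]/Rintegral (muE (fun x => expR (h x - g x))); last first.
    exact: integrable_expR.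
  rewrite (eq_integral (fun x => (expR (h x))%:E * Z^-1%:E)%E); last first.
    by move=> x _; rewrite mulrA -expRD subrK EFinM.
  rewrite integralZr//; last exact: integrable_expR.
  by rewrite EFin_Rintegral_expR.
have := Rintegral_le_ln_expR mu _ mhg bhg.
rewrite E RintegralB//; [|exact: finite_measure_bounded_integrable..].
rewrite ln_div ?posrE ?Rintegral_expR_gt0//.
by rewrite lerBlDr addrC addrA addrAC => hle; rewrite lerBlDr.
Qed.

Local Open Scope ereal_scope.

Theorem theorem3p4 (R : realType) (S : ptopologicalType) (hS : polish R S)
    (nu : probability (borel S) R) (Gamma : set (S -> R))
    (hGamma : admissible Gamma) (g : S -> R) (hg : Gamma g) :
  lne (\int[nu]_x (expR (g x))%:E) =
  ereal_sup [set \int[mu]_x (g x)%:E - Gdivergence Gamma mu nu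
            | mu in [set: probability (borel S) R]].
Proof.
have mG h : Gamma h -> measurable_fun setT (h : borel S -> R).
  by case/(admissible_Cb hGamma) => /continuous_borel_measurable.
have bG h : Gamma h -> bounded_fun (h : borel S -> R).
  by case/(admissible_Cb hGamma).
have lneG h : Gamma h ->
    lne (\int[nu]_x (expR (h x))%:E) = (ln (\int[nu]_x expR (h x))%R)%:E.
  by move=> Gh; rewrite lne_integral_expR//; [exact: mG|exact: bG].
have intG (mu : probability (borel S) R) h : Gamma h ->
    \int[mu]_x (h x)%:E = (\int[mu]_x h x)%R%:E.
  move=> Gh; rewrite /Rintegral fineK//; apply: integrable_fin_num => //.
  by apply: finite_measure_bounded_integrable; [exact: mG|exact: bG].
apply/eqP; rewrite eq_le; apply/andP; split.
- have [mu mu_max] := gibbs_measure_maximizes _ _ _ nu g (mG _ hg) (bG _ hg).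
  apply: le_trans (ereal_sup_ubound _); last by exists mu.
  have : Gdivergence Gamma mu nu <=
      (\int[mu]_x g x - ln (\int[nu]_x expR (g x)))%R%:E.
    apply: ge_ereal_sup => _ [h Gh <-].
    rewrite lneG// intG// -EFinB lee_fin.
    by apply: mu_max; [exact: mG|exact: bG].
  rewrite lneG// intG//; case: (Gdivergence _ _ _) => [r| |]//=;
    last by rewrite addey// leey.
  by rewrite -EFinB !lee_fin lerBrDr addrC -lerBrDr.
- apply: ge_ereal_sup => _ [mu _ <-].
  have : \int[mu]_x (g x)%:E - lne (\int[nu]_x (expR (g x))%:E) <=
    Gdivergence Gamma mu nu by apply: ereal_sup_ubound; exists g.
  rewrite lneG// !intG//; case: (Gdivergence _ _ _) => [r| |]//=;
    last by rewrite addeNy leNye.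
  by rewrite -!EFinB !lee_fin lerBlDr addrC -lerBlDr.
Qed.
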